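(* Let $Q^n=[0,1]^n$ be the $n$-dimensional cell, and let $D_t\subset Q^n$, $t\in[0,1]$, be a family of expanding domains, i.e. $D_{t_1}\subset D_{t_2}$ for any $t_1<t_2$. Consider the curve $S$ in $L^2(Q^n)$ defined by $S(t)=\chi_{D_t}\in L^2(Q^n)$, $t\in[0,1]$. Then $S(t)$ is a crinkled curve (crinkled arc) in $L^2(Q^n)$.
   Context: $\chi_D$ denotes the characteristic function of $D$. A curve $\psi:[0,1]\to\mathcal{X}$ in a Hilbert space $\mathcal{X}$ is called a crinkled arc (also called a crinkled curve) if it is continuous and any two disjoint chords of it are orthogonal, namely, for all $0\le s<t\le s'<t'\le 1$ one has $(\psi_t-\psi_s,\ \psi_{t'}-\psi_{s'})=0$.
   Formalization: The domains D_t are taken Borel measurable, and the Lebesgue measure of D_t is assumed continuous in t; without this the claim fails (a family that jumps gives a discontinuous S), and it is necessary for S to be a crinkled arc. *)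

(* Defs.v *)
From HB Require Import structures.
From mathcomp Require Import all_boot all_order all_algebra.
From mathcomp Require Import ring_quotient.
From mathcomp Require Import all_classical all_reals all_analysis.
From mathcomp Require Import measurable_realfun.

Set Implicit Arguments.
Unset Strict Implicit.
Unset Printing Implicit Defensive.
Import Order.TTheory GRing.Theory Num.Theory.
Import numFieldNormedType.Exports.

Local Open Scope classical_set_scope.
Local Open Scope ring_scope.
Local Open Scope quotient_scope.

(* Real inner product spaces, as normed modules whose norm comes from a
   symmetric bilinear form; the positive-definiteness of the form follows from
   inner_norm.  Completeness is not part of the structure. *)
HB.mixin Record NormedModule_isInnerProduct (R : realType) X
    & NormedModule R X := {
  inner : X -> X -> R ;
  innerC : forall x y, inner x y = inner y x ;
  innerPl : forall a x y z, inner (a *: x + y) z = a * inner x z + inner y z ;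
  inner_norm : forall x, inner x x = `|x| ^+ 2
}.

#[short(type="innerProductType")]
HB.structure Definition InnerProduct (R : realType) :=
  {X of NormedModule R X & NormedModule_isInnerProduct R X}.

Definition unit_interval (R : realType) : set R := `[0, 1]%classic.
Arguments unit_interval : clear implicits.

Definition is_crinkled_arc (R : realType) (X : innerProductType R)
    (psi : unit_interval R -> X) : Prop :=
  continuous psi /\
  forall s t s' t' : unit_interval R,
    \val s < \val t -> \val t <= \val s' -> \val s' < \val t' ->
    inner (psi t - psi s) (psi t' - psi s') = 0.

(* The space L^2(mu): the functions of LfunType, which are not identified when
   they agree almost everywhere, modulo the subspace of almost everywhere null
   functions. *)
Section L2.
Context d (T : measurableType d) (R : realType).
Variable mu : {measure set T -> \bar R}.

Local Notation L2fun := (LfunType mu (lee1n 2)).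

Let LfunB (f g : L2fun) x : (f - g) x = f x - g x. Proof. by []. Qed.

Let LfunZ a (f : L2fun) x : (a *: f) x = a * f x. Proof. by []. Qed.

Definition ae_null : {pred L2fun} :=
  fun f => `[< (f : T -> R) = cst 0 %[ae mu] >].

Lemma ae_null_zmod_closed : zmod_closed ae_null.
Proof.
split; first exact/asboolP/ae_eq_refl.
move=> f g /asboolP f0 /asboolP g0; apply/asboolP.
by move: f0 g0; apply: filterS2 => x f0 g0 xT; rewrite LfunB f0// g0// subrr.
Qed.

HB.instance Definition _ :=
  GRing.isZmodClosed.Build L2fun ae_null ae_null_zmod_closed.

Definition L2 : Type := Quotient.quot ae_null.
HB.instance Definition _ := GRing.Zmodule.on L2.
HB.instance Definition _ := EqQuotient.on L2.

Definition L2class (f : L2fun) : L2 := \pi_L2 f.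
Definition L2repr (x : L2) : L2fun := repr x.

Lemma L2reprK x : L2class (L2repr x) = x.
Proof. exact: reprK. Qed.

Lemma L2classP (f g : L2fun) :
  (f : T -> R) = g %[ae mu] <-> L2class f = L2class g.
Proof.
split.
  move=> fg; apply/eqmodP => /=; apply/asboolP.
  by move: fg; apply: filterS => x fg xT; rewrite LfunB fg// subrr.
move/eqmodP => /= /asboolP.
by apply: filterS => x /[apply] /eqP; rewrite LfunB subr_eq0 => /eqP.
Qed.

Lemma L2reprE (f : L2fun) : (L2repr (L2class f) : T -> R) = f %[ae mu].
Proof. by apply/L2classP; rewrite L2reprK. Qed.

Lemma L2classD (f g : L2fun) : L2class (f + g) = L2class f + L2class g.
Proof. by rewrite /L2class !piE. Qed.

Definition L2scale (a : R) (x : L2) : L2 := L2class (a *: L2repr x).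

Lemma L2scaleE a (f : L2fun) : L2scale a (L2class f) = L2class (a *: f).
Proof.
apply/L2classP.
by move: (L2reprE f); apply: filterS => x fE xT; rewrite !LfunZ fE.
Qed.

Let L2scalerA a b x : L2scale a (L2scale b x) = L2scale (a * b) x.
Proof. by rewrite -(L2reprK x) !L2scaleE scalerA. Qed.

Let L2scale1r : left_id 1 L2scale.
Proof. by move=> x; rewrite -(L2reprK x) !L2scaleE scale1r. Qed.

Let L2scalerDr : right_distributive L2scale +%R.
Proof.
move=> a x y; rewrite -(L2reprK x) -(L2reprK y) !L2scaleE -!L2classD.
by rewrite L2scaleE scalerDr.
Qed.

Let L2scalerDl x : {morph L2scale^~ x : a b / a + b}.
Proof.
by move=> a b; rewrite -(L2reprK x) !L2scaleE -!L2classD scalerDl.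
Qed.

HB.instance Definition _ := GRing.Zmodule_isLmodule.Build R L2
  L2scalerA L2scale1r L2scalerDr L2scalerDl.

Lemma L2classZ a (f : L2fun) : L2class (a *: f) = a *: L2class f.
Proof. by rewrite -L2scaleE. Qed.

Definition L2norm (x : L2) : R := fine ('N[mu]_2 [EFin \o L2repr x])%E.

Definition L2inner (x y : L2) : R :=
  (\int[mu]_t (L2repr x t * L2repr y t))%R.

Lemma integrable_L2mul (f g : L2fun) :
  mu.-integrable setT (EFin \o (fun t => f t * g t)).
Proof. by apply/Lfun1_integrable/Lfun2_mul_Lfun1; exact: LfunP. Qed.

Lemma L2innerE (f g : L2fun) :
  L2inner (L2class f) (L2class g) = (\int[mu]_t (f t * g t))%R.
Proof.
rewrite /L2inner /Rintegral; congr fine.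
apply: ae_eq_integral => //.
- have /integrableP[//] :=
    integrable_L2mul (L2repr (L2class f)) (L2repr (L2class g)).
- by have /integrableP[] := integrable_L2mul f g.
- move: (L2reprE f) (L2reprE g); apply: filterS2 => x fE gE xT.
  by rewrite fE// gE.
Qed.

Lemma measurable_L2sqr (f : L2fun) :
  measurable_fun [set: T] (fun t => `|(EFin \o f) t| `^ 2)%E.
Proof.
apply: (@measurableT_comp _ _ _ _ _ _ (fun y : \bar R => y `^ 2)%E).
  exact: measurable_poweR.
by apply: measurableT_comp => //; exact/measurable_EFinP.
Qed.

Lemma L2normE (f : L2fun) :
  L2norm (L2class f) = fine ('N[mu]_2 [EFin \o f])%E.
Proof.
rewrite /L2norm unlock; congr (fine (_ `^ _)%E).
apply: ae_eq_integral => //; try exact: measurable_L2sqr.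
by move: (L2reprE f); apply: filterS => x fE xT; rewrite /= fE.
Qed.

Let L2normD x y : L2norm (x + y) <= L2norm x + L2norm y.
Proof.
rewrite -(L2reprK x) -(L2reprK y) -L2classD !L2normE; exact: ler_LnormD.
Qed.

Let L2normZ a x : L2norm (a *: x) = `|a| * L2norm x.
Proof.
rewrite -(L2reprK x) -L2classZ !L2normE.
have := LnormZ (L2repr x) a => /= ->.
by rewrite fineM// -finite_norm_fine.
Qed.

Let L2norm0_eq0 x : L2norm x = 0 -> x = 0.
Proof.
move=> /fine_Lnormr_eq0 x0.
have -> : 0 = L2class 0 by rewrite /L2class !piE.
by rewrite -(L2reprK x); exact/L2classP.
Qed.

HB.instance Definition _ := Lmodule_isNormed.Build R L2
  L2normD L2normZ L2norm0_eq0.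

Let L2innerC x y : L2inner x y = L2inner y x.
Proof. by rewrite /L2inner; under eq_Rintegral do rewrite mulrC. Qed.

Let L2innerPl a x y z :
  L2inner (a *: x + y) z = a * L2inner x z + L2inner y z.
Proof.
rewrite -(L2reprK x) -(L2reprK y) -(L2reprK z) -L2classZ -L2classD !L2innerE.
rewrite -RintegralZl//; last exact: integrable_L2mul.
rewrite -RintegralD//; last exact: integrable_L2mul.
  by apply: eq_Rintegral => t _ /=; rewrite mulrDl mulrA.
have := integrable_L2mul (a *: L2repr x) (L2repr z).
by under [X in _.-integrable _ (_ \o X)]eq_fun do rewrite LfunZ -mulrA.
Qed.

Let L2inner_norm x : L2inner x x = `|x| ^+ 2.
Proof.
rewrite -(L2reprK x) L2innerE [`|_|]L2normE.
rewrite -powR_mulrn ?fine_ge0 ?Lnorm_ge0// -fine_poweR.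
rewrite poweR_Lnorm// /Rintegral; congr fine.
apply: eq_integral => t _ /=.
by rewrite powR_mulrn// real_normK ?num_real// expr2.
Qed.

HB.instance Definition _ := NormedModule_isInnerProduct.Build R L2
  L2innerC L2innerPl L2inner_norm.

End L2.

Arguments L2class {d T R mu}.

Section L2indic.
Context d (T : measurableType d) (R : realType).
Variables (mu : {finite_measure set T -> \bar R}) (D : set T).
Hypothesis mD : measurable D.

Lemma indic_Lfun2 : (\1_D : T -> R) \in Lfun mu 2%:E.
Proof.
rewrite inE/=; apply/andP; split; rewrite inE/=; first exact: measurable_indic.
rewrite /finite_norm unlock poweR_lty//.
under eq_integral => x _.
  have -> : (`|(EFin \o \1_D) x| `^ 2 = (\1_D x)%:E :> \bar R)%E.
    rewrite /= powR_mulrn// indicE.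
    by case: (x \in D); rewrite ?normr1 ?normr0 ?expr1n ?expr0n.
  over.
rewrite integral_indic// setIT.
by have := fin_num_measure mu _ mD; rewrite ge0_fin_numE.
Qed.

Definition L2indic : L2 mu := L2class (Lfun_Sub (lee1n 2) indic_Lfun2).

End L2indic.
Arguments L2indic {d T R} mu {D}.

Lemma sigma_finite_prod d1 d2 (T1 : measurableType d1) (T2 : measurableType d2)
    (R : realType) (m1 : {sigma_finite_measure set T1 -> \bar R})
    (m2 : {sigma_finite_measure set T2 -> \bar R}) :
  sigma_finite setT (m1 \x m2)%E.
Proof.
have /sigma_finiteP[F [TF ndF Foo]] := sigma_finiteT m1.
have /sigma_finiteP[G [TG ndG Goo]] := sigma_finiteT m2.
exists (fun n => F n `*` G n).
  rewrite -setXTT TF TG predeqE => -[x y]; split.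
    move=> [/= [n _ Fnx] [k _ Gky]]; exists (maxn n k) => //; split.
    - by move: x Fnx; exact/subsetPset/ndF/leq_maxl.
    - by move: y Gky; exact/subsetPset/ndG/leq_maxr.
  by move=> [n _ []/= ? ?]; split; exists n.
move=> k; have [? ?] := Foo k; have [? ?] := Goo k.
split; first exact: measurableX.
by rewrite product_measure1E// lte_mul_pinfty// ge0_fin_numE.
Qed.

Section lebesgue_tuple.
Context (R : realType).

Definition tcons n (p : R * n.-tuple R) : n.+1.-tuple R :=
  [tuple of p.1 :: p.2].

Lemma measurable_tcons n : measurable_fun [set: R * n.-tuple R] (@tcons n).
Proof. exact: (measurable_cons measurable_fst measurable_snd). Qed.

Section step.
Variables (n : nat) (m : {sigma_finite_measure set (n.-tuple R) -> \bar R}).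

Definition lebesgue_cons : set (n.+1.-tuple R) -> \bar R :=
  pushforward (@lebesgue_measure R \x m)%E (@tcons n).

Let lebesgue_cons0 : lebesgue_cons set0 = 0%E.
Proof. by rewrite /lebesgue_cons /pushforward preimage_set0 measure0. Qed.

Let lebesgue_cons_ge0 A : (0 <= lebesgue_cons A)%E.
Proof. by rewrite /lebesgue_cons /pushforward; apply: measure_ge0. Qed.

Let lebesgue_cons_sigma_additive : semi_sigma_additive lebesgue_cons.
Proof.
move=> F mF tF mUF; rewrite /lebesgue_cons /pushforward preimage_bigcup.
apply: measure_semi_sigma_additive.
- by move=> k; rewrite -[X in measurable X]setTI; exact: measurable_tcons.
- apply/trivIsetP => /= i j _ _ ij; rewrite -preimage_setI.
  by move/trivIsetP : tF => /(_ _ _ _ _ ij) ->//; rewrite preimage_set0.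
- rewrite -preimage_bigcup -[X in measurable X]setTI.
  exact: measurable_tcons.
Qed.

HB.instance Definition _ := isMeasure.Build _ _ _ lebesgue_cons
  lebesgue_cons0 lebesgue_cons_ge0 lebesgue_cons_sigma_additive.

Lemma tuncons_measurable (F : set (R * n.-tuple R)) : measurable F ->
  measurable [set v : n.+1.-tuple R | F (thead v, [tuple of behead v])].
Proof.
move=> mF; rewrite -[X in measurable X]setTI.
have muncons : measurable_fun [set: n.+1.-tuple R]
    (fun v => (thead v, [tuple of behead v])).
  apply: measurable_fun_pair; first exact: measurable_tnth.
  exact: measurable_behead.
exact: muncons.
Qed.

Let lebesgue_cons_sigma_finite : sigma_finite setT lebesgue_cons.
Proof.
have [F FT mF] := sigma_finite_prod (@lebesgue_measure R) m.
exists (fun k => [set v : n.+1.-tuple R | F k (thead v, [tuple of behead v])]).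
  apply/seteqP; split => // v _.
  have : [set: R * n.-tuple R] (thead v, [tuple of behead v]) by [].
  by rewrite FT => -[k _ Fk]; exists k.
move=> k; have [mFk Fkoo] := mF k; split; first exact: tuncons_measurable.
rewrite /lebesgue_cons /pushforward (_ : _ @^-1` _ = F k)//.
apply/seteqP; split => -[x v] /=; rewrite theadE;
  by rewrite (_ : [tuple of _] = v)//; apply: val_inj.
Qed.

HB.instance Definition _ := Measure_isSigmaFinite.Build _ _ _ lebesgue_cons
  lebesgue_cons_sigma_finite.

End step.

(* The n-dimensional Lebesgue measure, as the n-fold product of the Lebesgue
   measure on R; see lebesgue_tuple_box for its value on boxes. *)
Fixpoint lebesgue_tuple n : {sigma_finite_measure set (n.-tuple R) -> \bar R} :=
  if n is m.+1 then lebesgue_cons (lebesgue_tuple m)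
  else dirac [tuple of [::]].

Lemma measurable_box n (A : 'I_n -> set R) : (forall i, measurable (A i)) ->
  measurable [set v : n.-tuple R | forall i, A i (tnth v i)].
Proof.
move=> mA; rewrite [X in measurable X](_ : _ =
    \bigcap_(i in [set: 'I_n]) ((fun v : n.-tuple R => tnth v i) @^-1` A i)).
  apply: fin_bigcap_measurable => // i _.
  by rewrite -[X in measurable X]setTI; exact: measurable_tnth.
by apply/seteqP; split => v /= vA i; [move=> _; exact: vA|exact: (vA i)].
Qed.

Lemma lebesgue_tuple_box n (A : 'I_n -> set R) :
  (forall i, measurable (A i)) ->
  lebesgue_tuple n [set v | forall i, A i (tnth v i)] =
  (\prod_(i < n) lebesgue_measure (A i))%E.
Proof.
elim: n A => [|n IHn] A mA /=.
  by rewrite big_ord0 diracE mem_set//= => -[].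
rewrite big_ord_recl -IHn; last by move=> i; exact: mA.
rewrite -product_measure1E; [|exact: (mA ord0)|
  exact: (measurable_box (A := fun i => A (lift ord0 i)))].
congr product_measure1; apply/seteqP; split => -[x v] /=.
  move=> vA; split=> [|i]; first exact: (vA ord0).
  by have := vA (lift ord0 i); rewrite tnthS.
move=> [xA vA] i; by have [j ->|-> //] := unliftP ord0 i; rewrite tnthS.
Qed.

Definition unit_cell n : set (n.-tuple R) :=
  [set v | forall i, tnth v i \in `[0, 1]].

Lemma measurable_unit_cell n : measurable (@unit_cell n).
Proof. by apply: (measurable_box (A := fun=> `[0, 1]%classic)). Qed.

Lemma lebesgue_unit_cell n : lebesgue_tuple n (@unit_cell n) = 1%E.
Proof.
rewrite (lebesgue_tuple_box (A := fun=> `[0, 1]%classic))//.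
by rewrite big1// => i _; rewrite lebesgue_measure_itv/= lte_fin ltr01 sube0.
Qed.

Lemma lebesgue_unit_cell_lty n : (lebesgue_tuple n (@unit_cell n) < +oo)%E.
Proof. by rewrite lebesgue_unit_cell ltry. Qed.

(* L2 (cell_measure n) renders L^2([0, 1]^n): the functions are defined on the
   whole of R^n, but their values outside [0, 1]^n are irrelevant. *)
Definition cell_measure n : {finite_measure set (n.-tuple R) -> \bar R} :=
  mfrestr (@measurable_unit_cell n) (lebesgue_unit_cell_lty n).

End lebesgue_tuple.
Arguments unit_cell {R} n.

(* Main.v *)
Require Import Defs.
From HB Require Import structures.
From mathcomp Require Import all_boot all_order all_algebra.
From mathcomp Require Import all_classical all_reals all_analysis.
From mathcomp Require Import measurable_realfun.

Set Implicit Arguments.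
Unset Strict Implicit.
Unset Printing Implicit Defensive.
Import Order.TTheory GRing.Theory Num.Theory.
Import numFieldNormedType.Exports.

Local Open Scope classical_set_scope.
Local Open Scope ring_scope.

(** Write S t for the class of the indicator function of D t, and mu for the
measure.  If s <= t then S t - S s is the class of the indicator function of the
increment [D t `\` D s] ([L2indicB]).  The inner product of two
indicator functions is the measure of the intersection of the two sets
([inner_L2indic]); two consequences follow.

Increments over non-overlapping parameter intervals are disjoint sets, so the
corresponding chords are orthogonal ([inner_L2indic_chords]).

The squared length of a chord is the measure of the increment, that is,
[`|mu (D t) - mu (D s)|] ([sqr_norm_L2indicB]).  Hence S is continuous as soon as
t |-> mu (D t) is. *)

Section L2indic_theory.
Context d (T : measurableType d) (R : realType).
Variable mu : {finite_measure set T -> \bar R}.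
Implicit Types A B : set T.

Lemma inner_L2indic A B (mA : measurable A) (mB : measurable B) :
  inner (L2indic mu mA) (L2indic mu mB) = fine (mu (A `&` B)).
Proof.
rewrite [LHS]L2innerE /Rintegral; congr fine.
transitivity (\int[mu]_x (\1_(A `&` B) x)%:E)%E.
  by apply: eq_integral => x _; rewrite indicI.
by rewrite integral_indic ?setIT//; exact: measurableI.
Qed.

Lemma L2indicB A B (mA : measurable A) (mB : measurable B)
    (mBA : measurable (B `\` A)) : A `<=` B ->
  L2indic mu mB - L2indic mu mA = L2indic mu mBA.
Proof.
move=> AB; apply/eqP; rewrite subr_eq; apply/eqP.
rewrite /L2indic -L2classD; congr L2class.
apply/val_inj/funext => x /=.
(* Addition in the space of square-integrable functions is pointwise. *)
change (\1_B x = \1_(B `\` A) x + \1_A x :> R).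
rewrite !indicE in_setD; have [xA|xA] := boolP (x \in A).
  by rewrite andbF add0r mem_set//; apply: AB; exact: set_mem.
by rewrite andbT addr0.
Qed.

Lemma inner_L2indic_chords A B A' B' (mA : measurable A) (mB : measurable B)
    (mA' : measurable A') (mB' : measurable B') :
  A `<=` B -> B `<=` A' -> A' `<=` B' ->
  inner (L2indic mu mB - L2indic mu mA) (L2indic mu mB' - L2indic mu mA') = 0.
Proof.
move=> AB BA' AB'.
rewrite (L2indicB mA mB (measurableD mB mA))//.
rewrite (L2indicB mA' mB' (measurableD mB' mA'))// inner_L2indic.
rewrite (_ : _ `&` _ = set0) ?measure0//.
by apply/seteqP; split => // x [[/BA' xA' _] [_ /(_ xA')]].
Qed.

(** The two sets only need to be comparable for inclusion, in either order: the
continuity proof compares D s and D t with s on either side of t. *)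
Lemma sqr_norm_L2indicB A B (mA : measurable A) (mB : measurable B) :
  A `<=` B \/ B `<=` A ->
  `|L2indic mu mB - L2indic mu mA| ^+ 2 = `|fine (mu B) - fine (mu A)|.
Proof.
wlog AB : A B mA mB / A `<=` B.
  move=> wlogAB [AB|BA]; first by apply: wlogAB => //; left.
  by rewrite distrC [RHS]distrC; apply: wlogAB => //; left.
move=> _; rewrite (L2indicB mA mB (measurableD mB mA))//.
rewrite -inner_norm inner_L2indic setIid measureD//; last first.
  by have := fin_num_measure mu _ mB; rewrite ge0_fin_numE.
rewrite (_ : B `&` A = A); last by rewrite setIC; exact/setIidl.
rewrite fineB ?fin_num_measure// ger0_norm// subr_ge0.
by rewrite fine_le ?fin_num_measure// le_measure// inE.
Qed.

Lemma continuous_L2indic (U : topologicalType) (D : U -> set T)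
    (mD : forall t, measurable (D t)) :
  (forall s t, D s `<=` D t \/ D t `<=` D s) ->
  continuous (fun t => mu (D t)) ->
  continuous (fun t => L2indic mu (mD t)).
Proof.
move=> Dtot muD t; apply/cvgrPdist_lt => e e0.
have muDt : fine (mu (D s)) @[s --> t] --> fine (mu (D t)).
  by apply: fine_cvg; rewrite fineK ?fin_num_measure//; exact: muD.
have e20 : 0 < e ^+ 2 by rewrite exprn_gt0.
move/cvgrPdist_lt : muDt => /(_ _ e20); apply: filterS => s.
rewrite -(sqr_norm_L2indicB (mD s) (mD t))//.
by rewrite ltr_pXn2r// nnegrE ?normr_ge0// ltW.
Qed.

End L2indic_theory.

Theorem proposition2p4 (R : realType) (n : nat)
    (D : unit_interval R -> set (n.-tuple R))
    (mD : forall t, measurable (D t))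
    (DQ : forall t, D t `<=` unit_cell n)
    (Dincr : forall s t : unit_interval R, \val s < \val t -> D s `<=` D t)
    (Dcont : continuous (fun t => lebesgue_tuple R n (D t))) :
  is_crinkled_arc (fun t => L2indic (cell_measure R n) (mD t)).
Proof.
have Dle (s t : unit_interval R) : \val s <= \val t -> D s `<=` D t.
  by rewrite le_eqVlt => /orP[/eqP/val_inj ->//|/Dincr].
split; last first.
  by move=> s t s' t' st ts' st'; apply: inner_L2indic_chords; apply: Dle => //;
    exact: ltW.
apply: continuous_L2indic.
  by move=> s t; have [|/ltW] := leP (\val s) (\val t) => /Dle; [left|right].
(* Each D t lies in the unit cell, so restricting the measure to the cell does
   not change the measure of D t. *)
rewrite (_ : (fun t => _) = (fun t => lebesgue_tuple R n (D t)))//.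
apply/funext => t; rewrite /cell_measure /= /mfrestr /mrestr.
by congr (lebesgue_tuple R n _); exact/setIidl.
Qed.
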